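(* Let $G$ be a hypergraph with vertex set $\{1,\dots,n\}$ and $m$ hyperedges, let $M$ be its $n\times m$ vertex-edge incidence matrix, and let $f:\{0,1\}^n\to\{0,1\}$ be the Boolean function determining the hypergraph state $|G\rangle$. For $i\in[2^n]$, let $k$ be the number of zero entries of the vector $M^t\left(j_n-\mathrm{bin}(i)^t\right)$, where $j_n$ is the all-ones column vector of dimension $n$. Then $f(\mathrm{bin}(i))=k \bmod 2$.
   Context: $[2^n]=\{0,1,\dots,2^n-1\}$, and $\mathrm{bin}(i)=(i_1,\dots,i_n)\in\{0,1\}^n$ is the $n$-term binary representation of $i$ (most significant digit first), regarded as a row vector with integer entries. $|0\rangle,|1\rangle$ is the standard basis of $\mathcal H_2=\mathbb C^2$, and $|\mathrm{bin}(i)\rangle=|i_1\rangle\otimes\cdots\otimes|i_n\rangle$. A hypergraph $G=(V(G),E(G))$ has vertex set $V(G)=\{1,\dots,n\}$ and a set $E(G)$ of hyperedges, each a subset of $V(G)$. The vertex-edge incidence matrix $M=(m_{v,e})$ is the integer matrix with rows indexed by vertices and columns by hyperedges, $m_{v,e}=1$ if $v\in e$ and $m_{v,e}=0$ otherwise; matrix products are computed over the integers. For $e\subseteq V(G)$, $Z_e$ is the linear operator on $\mathcal H_2^{\otimes n}$ with $Z_e|\mathrm{bin}(i)\rangle=-|\mathrm{bin}(i)\rangle$ if $i_v=1$ for all $v\in e$, and $Z_e|\mathrm{bin}(i)\rangle=|\mathrm{bin}(i)\rangle$ otherwise. With $|+\rangle=\frac1{\sqrt2}(|0\rangle+|1\rangle)$,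 the hypergraph state is $|G\rangle=\left(\prod_{e\in E(G)}Z_e\right)|+\rangle^{\otimes n}$. The Boolean function determining $|G\rangle$ is the unique $f:\{0,1\}^n\to\{0,1\}$ with $|G\rangle=\frac1{\sqrt{2^n}}\sum_{i\in[2^n]}(-1)^{f(\mathrm{bin}(i))}|\mathrm{bin}(i)\rangle$. *)

(* Defs.v *)
From HB Require Import structures.
From mathcomp Require Import all_boot all_order all_algebra.
From mathcomp Require Import reals complex mxtens.

Set Implicit Arguments.
Unset Strict Implicit.
Unset Printing Implicit Defensive.

Import Order.TTheory GRing.Theory Num.Theory.
Local Open Scope ring_scope.
Local Open Scope complex_scope.

(* The vertex labelled v + 1 in {1, ..., n} is the ordinal v : 'I_n. *)
Record hypergraph (n : nat) := Hypergraph { hyperedges : {set {set 'I_n}} }.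

(* Most significant digit first: the entry v has weight 2 ^ (n - 1 - v). *)
Definition bin (n : nat) (i : 'I_(2 ^ n)) : 'rV[bool]_n :=
  \row_(v < n) odd (i %/ 2 ^ (n - v.+1)).

Definition int_of_bits (n : nat) (x : 'rV[bool]_n) : 'rV[int]_n :=
  map_mx (fun b : bool => (b : nat)%:Z) x.

(* The columns are listed in the order of [enum (hyperedges G)]. *)
Definition incidence (n : nat) (G : hypergraph n) :
    'M[int]_(n, #|hyperedges G|) :=
  \matrix_(v < n, j < #|hyperedges G|) ((v \in enum_val j) : nat)%:Z.

Definition qubit (R : realType) (b : bool) : 'cV[R[i]]_2 :=
  delta_mx (inord b) ord0.

Definition ket_plus (R : realType) : 'cV[R[i]]_2 :=
  (Num.sqrt 2 : R)%:C^-1 *: (qubit R false + qubit R true).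

(* The n-th tensor power of C^2 is C^(2 ^ n), tensors being Kronecker products;
   [tens_ket u] is u_0 (x) ... (x) u_(n-1). *)
Fixpoint tens_ket (R : realType) (n : nat) :
    ('I_n -> 'cV[R[i]]_2) -> 'cV[R[i]]_(2 ^ n) :=
  match n with
  | 0 => fun _ => const_mx 1
  | n'.+1 => fun u =>
      castmx (esym (expnS 2 n'), muln1 1)
        (u ord0 *t tens_ket (fun v : 'I_n' => u (lift ord0 v)))
  end.

Definition ket (R : realType) (n : nat) (x : 'rV[bool]_n) : 'cV[R[i]]_(2 ^ n) :=
  tens_ket (fun v => qubit R (x ord0 v)).

(* Z_e, in the basis |bin 0>, ..., |bin (2 ^ n - 1)>, which is the canonical
   basis by [ket_bin] below; [Zop_ket] is its characterization on that basis. *)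
Definition Zop (R : realType) (n : nat) (e : {set 'I_n}) : 'M[R[i]]_(2 ^ n) :=
  diag_mx (\row_(i < 2 ^ n)
    (if [forall v in e, bin i ord0 v] then -1 else 1)).

(* The operators Z_e commute, so the order of the product is immaterial. *)
Definition hypergraph_state (R : realType) (n : nat) (G : hypergraph n) :
    'cV[R[i]]_(2 ^ n) :=
  (\prod_(e in hyperedges G) Zop R e) *m tens_ket (fun _ : 'I_n => ket_plus R).

Definition determines (R : realType) (n : nat) (f : 'rV[bool]_n -> bool)
    (G : hypergraph n) : Prop :=
  hypergraph_state R G =
    (Num.sqrt (2 ^+ n) : R)%:C^-1 *:
      \sum_(i < 2 ^ n) (-1) ^+ f (bin i) *: ket R (bin i).

Lemma odd_divn_modX (n v k : nat) : (v < n)%N ->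
  odd (k %% 2 ^ n %/ 2 ^ (n - v.+1)) = odd (k %/ 2 ^ (n - v.+1)).
Proof.
move=> lt_vn; rewrite [in RHS](divn_eq k (2 ^ n)).
set q := (k %/ 2 ^ n)%N; set r := (k %% 2 ^ n)%N.
have -> : (q * 2 ^ n = q * 2 ^ v * 2 * 2 ^ (n - v.+1))%N.
  by rewrite -!mulnA -expnS -expnD addnC addSnnS subnK.
by rewrite divnMDl ?expn_gt0 // oddD !oddM /= andbF.
Qed.

Lemma tens_ketE (R : realType) n (u : 'I_n -> 'cV[R[i]]_2) (i : 'I_(2 ^ n)) :
  tens_ket u i ord0 = \prod_(v < n) u v (inord (bin i ord0 v)) ord0.
Proof.
elim: n u i => [|n IH] u i; first by rewrite big_ord0 mxE.
rewrite big_ord_recl /= castmxE mxE.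
have -> : (mxtens_unindex (cast_ord (esym (muln1 1)) (ord0 : 'I_1))).1 = ord0.
  exact: ord1.
have -> : (mxtens_unindex (cast_ord (esym (muln1 1)) (ord0 : 'I_1))).2 = ord0.
  exact: ord1.
have lti : (i %/ 2 ^ n < 2)%N.
  by rewrite ltn_divLR ?expn_gt0 // -expnS.
congr (u _ _ _ * _).
  apply: val_inj; rewrite /= mxE inordK /= ?subn1 /=; last by case: odd.
  by move: lti; case: (i %/ 2 ^ n)%N => [|[|]].
rewrite IH; apply: eq_bigr => v _; congr (u _ (inord _) _).
rewrite !mxE /= /bump /= add1n subSS; congr nat_of_bool.
exact: odd_divn_modX.
Qed.

Lemma bin_inj n : injective (@bin n).
Proof.
elim: n => [|n IH] i j eij; first by rewrite (ord1 i) (ord1 j).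
have lt k : (k %% 2 ^ n < 2 ^ n)%N by rewrite ltn_mod expn_gt0.
have E (k : 'I_(2 ^ n.+1)) (v : 'I_n) :
    bin k ord0 (lift ord0 v) = bin (Ordinal (lt k)) ord0 v.
  by rewrite !mxE /= /bump /= add1n subSS -odd_divn_modX.
have low : (i %% 2 ^ n = j %% 2 ^ n)%N.
  have /(congr1 val) // : Ordinal (lt i) = Ordinal (lt j).
  by apply: IH; apply/rowP => v; rewrite -!E eij.
have lt2 (k : 'I_(2 ^ n.+1)) : (k %/ 2 ^ n < 2)%N.
  by rewrite ltn_divLR ?expn_gt0 // -expnS.
have high : (i %/ 2 ^ n = j %/ 2 ^ n)%N.
  move/rowP/(_ ord0): eij; rewrite !mxE /= subn1 /=.
  move: (lt2 i) (lt2 j).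
  by case: (i %/ 2 ^ n)%N => [|[|]] //; case: (j %/ 2 ^ n)%N => [|[|]].
by apply: val_inj; rewrite /= (divn_eq i (2 ^ n)) (divn_eq j (2 ^ n)) low high.
Qed.

Lemma ket_bin (R : realType) n (i : 'I_(2 ^ n)) :
  ket R (bin i) = delta_mx i ord0.
Proof.
apply/colP => j; rewrite /ket tens_ketE mxE eqxx andbT.
have qE (b c : bool) : qubit R b (inord c) ord0 = (c == b)%:R.
  rewrite /qubit mxE eqxx andbT -val_eqE /= !inordK; [| by case: b | by case: c].
  by case: b; case: c.
under eq_bigr do rewrite qE.
case: eqVneq => [-> | neq_ji]; first by rewrite big1 // => v _; rewrite eqxx.
have /existsP[v nv] : [exists v, bin j ord0 v != bin i ord0 v].
  apply: contraNT neq_ji; rewrite negb_exists => /forallP eq_b.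
  by apply/eqP/bin_inj/rowP => v; apply/eqP; have := eq_b v; rewrite negbK.
by rewrite (bigD1 v) //= (negbTE nv) mul0r.
Qed.

Lemma Zop_ket (R : realType) n (e : {set 'I_n}) (i : 'I_(2 ^ n)) :
  Zop R e *m ket R (bin i) =
    if [forall v in e, bin i ord0 v] then - ket R (bin i) else ket R (bin i).
Proof.
rewrite ket_bin; apply/colP => j; rewrite mul_diag_mx !mxE.
case: (eqVneq j i) => [-> | ne].
  by case: ifP => _; rewrite !mxE !eqxx ?mulN1r ?mul1r.
by rewrite mulr0; case: ifP => _; rewrite !mxE (negbTE ne) ?oppr0.
Qed.

(* Main.v *)
(* All the operators are diagonal: the amplitude of |bin i> in |G> is 2^(-n/2)
   times one factor -1 for each hyperedge all of whose vertices carry the bit 1.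
   Entry e of M^t (j_n - bin(i)^t) counts the vertices of e carrying the bit 0,
   so these hyperedges are exactly the zero entries. *)

Require Import Defs.
From mathcomp Require Import all_boot all_order all_algebra.
From mathcomp Require Import reals.
From mathcomp Require Import complex.

Import Order.TTheory GRing.Theory Num.Theory.

Local Open Scope ring_scope.
Local Open Scope complex_scope.

Lemma prod_diag_mx (K : pzRingType) (n : nat) (I : Type) (r : seq I)
    (P : pred I) (d : I -> 'rV[K]_n) :
  \prod_(e <- r | P e) diag_mx (d e) =
    diag_mx (\row_i \prod_(e <- r | P e) d e ord0 i).
Proof.
elim: r => [|e r IH].
  rewrite big_nil; apply/matrixP => i j; rewrite !mxE.
  by rewrite big_nil.
rewrite big_cons IH; case: ifP => Pe.
  rewrite [_ * _]mulmx_diag; congr diag_mx; apply/rowP => i.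
  by rewrite !mxE big_cons Pe.
by congr diag_mx; apply/rowP => i; rewrite !mxE big_cons Pe.
Qed.

Lemma prod_Zop_mul (R : realType) (n : nat) (G : hypergraph n)
    (u : 'cV[R[i]]_(2 ^ n)) (i : 'I_(2 ^ n)) :
  ((\prod_(e in hyperedges G) Zop R e) *m u) i ord0 =
    (-1) ^+ #|[set j : 'I_#|hyperedges G| |
                [forall v in enum_val j, bin i ord0 v]]| * u i ord0.
Proof.
rewrite prod_diag_mx mul_diag_mx !mxE; congr (_ * _).
(* Hyperedges are reindexed by the columns of [incidence], and the power of -1 is unfolded into a
   product over the counted columns; both sides then have a factor -1 or 1 per column. *)
rewrite big_enum_val /= -prodr_const big_mkcond /= [RHS]big_mkcond /=.
by apply: eq_bigr => j _; rewrite mxE inE.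
Qed.

(** Both coordinates of [ket_plus] are the inverse of the square root of 2, so each of the [n]
    factors contributes the same scalar whatever the bits of [i]. *)
Lemma tens_ket_plusE (R : realType) (n : nat) (i : 'I_(2 ^ n)) :
  tens_ket (fun _ : 'I_n => ket_plus R) i ord0 =
    (Num.sqrt (2 ^+ n) : R)%:C^-1.
Proof.
have plusE (b : bool) : ket_plus R (inord b) ord0 = (Num.sqrt 2 : R)%:C^-1.
  rewrite /ket_plus /qubit !mxE eqxx !andbT -!val_eqE /= !inordK //.
    by case: b; rewrite ?add0r ?addr0 mulr1.
  by case: b.
rewrite tens_ketE (eq_bigr (fun=> (Num.sqrt 2 : R)%:C^-1)) => [|v _].
  rewrite prodr_const card_ord exprVn -rmorphXn /=; congr (_%:C^-1).
  elim: n {i} => [|m IH]; first by rewrite !expr0 sqrtr1.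
  by rewrite !exprS IH sqrtrM ?ler0n.
exact: plusE.
Qed.

(** The entry is a sum of nonnegative integers, with a term 1 for each vertex of the hyperedge
    carrying the bit 0, so it vanishes only when there is no such vertex. *)
Lemma incidence_entry_eq0 (n : nat) (G : hypergraph n) (x : 'rV[bool]_n)
    (j : 'I_#|hyperedges G|) :
  (((incidence G)^T *m (const_mx 1 - (int_of_bits x)^T)) j ord0 == 0) =
    [forall v in enum_val j, x ord0 v].
Proof.
rewrite mxE.
have termE (v : 'I_n) :
    (incidence G)^T j v * (const_mx 1 - (int_of_bits x)^T) v ord0 =
      ((v \in enum_val j) && ~~ x ord0 v)%:R.
  by rewrite !mxE; case: (v \in _); case: (x ord0 v).
rewrite (eq_bigr _ (fun v _ => termE v)) psumr_eq0 => [|v _]; last exact: ler0n.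
apply/allP/forall_inP => [h v ve|h v _]; last first.
  by apply/implyP => _; case: (boolP (v \in _)) => // /h ->.
have := h v (mem_index_enum v).
by rewrite ve /=; case: (x ord0 v).
Qed.

(** Both expressions of the state are compared at coordinate [i], and the common nonzero
    normalization cancels. *)
Lemma determines_sign (R : realType) (n : nat) (f : 'rV[bool]_n -> bool)
    (G : hypergraph n) (i : 'I_(2 ^ n)) :
  determines R f G ->
  (-1) ^+ f (bin i) = (-1) ^+ #|[set j : 'I_#|hyperedges G| |
                [forall v in enum_val j, bin i ord0 v]]| :> R[i].
Proof.
move=> /(congr1 (fun u : 'cV_(2 ^ n) => u i ord0)).
rewrite /hypergraph_state prod_Zop_mul tens_ket_plusE mxE summxE.
rewrite (bigD1 i) //= big1 => [|l nli]; last first.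
  by rewrite ket_bin !mxE eq_sym (negbTE nli) mulr0.
rewrite ket_bin !mxE !eqxx addr0 mulr1 mulrC => /mulfI ->//.
rewrite invr_eq0 (inj_eq (@complexI R)) sqrtr_eq0 -ltNge.
by rewrite exprn_gt0 ?ltr0n.
Qed.

Theorem theorem2 (R : realType) (n : nat) (G : hypergraph n)
    (f : 'rV[bool]_n -> bool) (hf : determines R f G)
    (i : 'I_(2 ^ n)) (k : nat)
    (hk : k = #|[set j : 'I_#|hyperedges G| |
                  ((incidence G)^T *m (const_mx 1 - (int_of_bits (bin i))^T))
                    j ord0 == 0]|) :
  (f (bin i) : nat) = (k %% 2)%N.
Proof.
have := determines_sign R n f G i hf.
under eq_finset do rewrite -incidence_entry_eq0.
(* Reducing the exponent to its parity makes both exponents Booleans, on which powers of -1 are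
   injective since 1 and -1 differ in [R[i]]. *)
rewrite -hk -[in RHS]signr_odd modn2.
by move/eqP; rewrite (inj_eq (@signr_inj _)) => /eqP ->.
Qed.
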